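(* Let $q$ be a prime power, let $l_1,\dots,l_t$ be distinct odd primes coprime to $q$, and let $r_1,\dots,r_t$ be positive integers. For each $i$ write $\mathrm{ord}_{l_i}(q)=2^{a_i}d_i$ with $a_i\ge 0$ an integer and $d_i\ge1$ odd. Then: (1) if there exists $j\in\{1,\dots,t\}$ with $a_j=0$ or $a_j\ge 2$, then $\left|\Omega_{q^2,\prod_{i=1}^{t}l_i^{r_i}}\right|=\left|\Omega_{q^2,\prod_{i\ne j}l_i^{r_i}}\right|$; (2) if $a_1=\dots=a_t=1$, then $\left|\Omega_{q^2,\prod_{i=1}^{t}l_i^{r_i}}\right|=\sum_{d\mid \prod_{i=1}^t l_i^{r_i}}\frac{\phi(d)}{\mathrm{ord}_d(q^2)}$; (3) if $a_i\ne 1$ for all $i\in\{1,\dots,t\}$, then $\left|\Omega_{q^2,\prod_{i=1}^{t}l_i^{r_i}}\right|=1$. Here an empty product is taken to be $1$.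
   Context: $\mathbb{F}_{q^2}$ is the finite field with $q^2$ elements. For $\alpha\in\mathbb{F}_{q^2}$ put $\bar\alpha=\alpha^q$, and for $f(x)=\sum_i f_ix^i$ put $\overline{f(x)}=\sum_i \bar f_i x^i$. For $f(x)$ with $f(0)\neq 0$, $f^*(x)=x^{\deg f}f(0)^{-1}f(1/x)$ and $f^\dagger(x)=\overline{f^*(x)}$. A polynomial is SCRIM if it is monic, irreducible over $\mathbb{F}_{q^2}$, has nonzero constant term, and satisfies $f=f^\dagger$. $\Omega_{q^2,n}$ denotes the set of SCRIM polynomials in $\mathbb{F}_{q^2}[x]$ dividing $x^n-1$. $\phi$ is Euler's totient function and $\mathrm{ord}_d(a)$ is the multiplicative order of $a$ modulo $d$. *)

(* Defs.v *)
From HB Require Import structures.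
From mathcomp Require Import all_boot all_order all_algebra.
From mathcomp Require Import qpoly.
Set Implicit Arguments. Unset Strict Implicit. Unset Printing Implicit Defensive.
Import GRing.Theory.
Local Open Scope ring_scope.

(* F plays the role of F_{q^2}; conjugation alpha |-> alpha^q. *)
Section Scrim.
Variables (F : finFieldType) (q : nat).

Definition qconj (a : F) : F := a ^+ q.

Definition pconj (f : {poly F}) : {poly F} := map_poly qconj f.

(* f^*(x) = x^{deg f} f(0)^{-1} f(1/x): coefficient i is f(0)^{-1} f_{deg f - i} *)
Definition recip (f : {poly F}) : {poly F} :=
  (f`_0)^-1 *: \poly_(i < size f) f`_((size f).-1 - i).

Definition dagger (f : {poly F}) : {poly F} := pconj (recip f).

(* SCRIM: monic, irreducible (library decision procedure irreducibleb,
   equivalent to irreducible_poly via qpoly.irreducibleP), nonzero constant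
   term, self-conjugate-reciprocal *)
Definition scrim (f : {poly F}) : bool :=
  [&& f \is monic, irreducibleb f, f`_0 != 0 & f == dagger f].

(* |Omega_{q^2,n}|: number of SCRIM divisors of x^n - 1.  For n >= 1 every
   divisor of x^n - 1 has size <= n+1, so all of them live in {poly_(n.+1) F}. *)
Definition Omega_card (n : nat) : nat :=
  #|[set f : {poly_(n.+1) F} | scrim f && (polyn f %| 'X^n - 1)]|.

End Scrim.

(* ord_d(a): the least k >= 1 with a^k = 1 (mod d); for gcd(a,d)=1 one has
   k <= phi(d) <= d, so searching k in 1..d suffices. *)
Definition ordmod (a d : nat) : nat :=
  (find (fun k => a ^ k.+1 == 1 %[mod d]) (iota 0 d)).+1.

Definition prime_power (q : nat) : Prop :=
  exists p k, [/\ prime p, (0 < k)%N & q = (p ^ k)%N].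

(* Main.v *)
(* Let K be an algebraic closure of F. An irreducible divisor f of X^n - 1 with
   a root b of order d has as roots the conjugates b^(q^(2j)), and is SCRIM iff
   b^(-q) is one of them, i.e. iff d divides q^k + 1 for some odd k. An odd prime
   l divides some q^k + 1 with k odd only if ord_l(q) is twice an odd number, so
   the primes l_i with a_i <> 1 never divide such a d. Conversely, if all a_i are
   1 then N itself divides some q^k + 1 with k odd (lift the congruence modulo
   l_i to l_i^r_i), every irreducible divisor of X^N - 1 is SCRIM, and those with
   roots of order d number phi(d) / ord_d(q^2). *)
Require Import Defs.
From HB Require Import structures.
From mathcomp Require Import all_boot all_order all_algebra.
From mathcomp Require Import qpoly.
From mathcomp Require Import cyclic separable cyclotomic finfield.
From mathcomp Require Import closed_field algebraics_fundamentals.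
Set Implicit Arguments. Unset Strict Implicit. Unset Printing Implicit Defensive.
Local Open Scope ring_scope.
Import GRing.Theory Num.Theory.

(** * Multiplicative orders and divisors of q^k + 1 with k odd *)

Lemma coprime_prodr (I : Type) (s : seq I) (P : pred I) (E : I -> nat) (m : nat) :
  (forall i, P i -> coprime m (E i)) -> coprime m (\prod_(i <- s | P i) E i)%N.
Proof.
by move=> co_mE; elim/big_ind: _ => // [|x y cx cy]; rewrite ?coprimen1 // coprimeMr cx.
Qed.

Lemma coprime_gt0l (m n : nat) : (1 < n)%N -> coprime m n -> (0 < m)%N.
Proof. by case: m => // n_gt1; rewrite /coprime gcd0n gtn_eqF. Qed.

Lemma ordmodP (a d : nat) : (0 < d)%N -> coprime a d ->
  [/\ (0 < ordmod a d)%N, a ^ ordmod a d = 1 %[mod d] &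
      forall k, (0 < k)%N -> a ^ k = 1 %[mod d] -> (ordmod a d <= k)%N].
Proof.
move=> d_gt0 co_ad; rewrite /ordmod; set P := fun k => _.
have hasP : has P (iota 0 d).
  (* Index k stands for the exponent k + 1, so Euler's exponent [totient d] sits one place earlier,
     within range as it is at most d. *)
  apply/hasP; exists (totient d).-1; last first.
    by rewrite /P prednK ?totient_gt0 //; apply/eqP/Euler_exp_totient.
  rewrite mem_iota /= add0n (leq_trans _ (_ : totient d <= d)%N) //.
    by rewrite prednK ?totient_gt0.
  rewrite totient_count_coprime big_mkord -[leqRHS]card_ord -sum1_card.
  by apply: leq_sum => i _; case: coprime.
split=> //.
  have := nth_find 0%N hasP; rewrite has_find size_iota in hasP.
  by rewrite nth_iota // add0n => /eqP.
case=> // k _ /eqP Pk; rewrite ltnS leqNgt; apply/negP => ltk.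
have := before_find 0%N ltk; rewrite has_find size_iota in hasP.
by rewrite nth_iota ?add0n /P ?Pk // (ltn_trans ltk).
Qed.

Lemma ordmod_dvd (a d k : nat) : (0 < d)%N -> coprime a d ->
  (ordmod a d %| k)%N = (a ^ k == 1 %[mod d]).
Proof.
move=> d_gt0 co_ad; have [o_gt0 ao1 min_o] := ordmodP d_gt0 co_ad.
have aoM m : a ^ (m * ordmod a d) = 1 %[mod d].
  by rewrite mulnC expnM -modnXm ao1 modnXm exp1n.
apply/idP/eqP => [/dvdnP[m ->] // | ak1].
rewrite /dvdn eqn0Ngt; apply/negP => r_gt0.
have := min_o _ r_gt0; rewrite leqNgt ltn_pmod // => /(_ _)/notF; apply.
by rewrite -ak1 {2}(divn_eq k (ordmod a d)) expnD -modnMml aoM modnMml mul1n.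
Qed.

Lemma eqn_mod1_dvd (d x : nat) : (0 < x)%N -> (x == 1 %[mod d]) = (d %| x.-1)%N.
Proof. by move=> x_gt0; rewrite eqn_mod_dvd // subn1. Qed.

Lemma dvdn_add1_sqr (d x : nat) : (0 < x)%N -> (d %| x + 1)%N -> x ^ 2 = 1 %[mod d].
Proof.
move=> x_gt0 dx; apply/eqP; rewrite eqn_mod_dvd ?expn_gt0 ?x_gt0 //.
by rewrite -(exp1n 2) subn_sqr dvdn_mull.
Qed.

Lemma dvdn_add1_exp_odd (x m : nat) : odd m -> (x + 1 %| x ^ m + 1)%N.
Proof.
move=> odd_m; case: (posnP x) => [->|x_gt0]; first by rewrite dvd1n.
rewrite -(odd_double_half m) odd_m -mul2n expnD expn1 expnM.
rewrite /dvdn -modnDml -modnMmr -modnXm (dvdn_add1_sqr x_gt0 (dvdnn _)).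
by rewrite modnXm exp1n modnMmr muln1 modnDml modnn.
Qed.

(** The order divides 2K but not K, since [l] dividing both q^K + 1 and q^K - 1 would divide 2. As K
    is odd, exactly one factor 2 remains. *)
Lemma logn2_ordmod (q l K : nat) : odd l -> (1 < l)%N -> coprime q l -> odd K ->
  (l %| q ^ K + 1)%N -> logn 2 (ordmod q l) = 1%N.
Proof.
move=> odd_l l_gt1 co_ql odd_K lqK; have l_gt0 := ltnW l_gt1.
have q_gt0 := coprime_gt0l l_gt1 co_ql.
have [o_gt0 _ _] := ordmodP l_gt0 co_ql.
have K_gt0 : (0 < K)%N by case: K odd_K {lqK}.
have o2K : (ordmod q l %| 2 * K)%N.
  rewrite ordmod_dvd // mulnC expnM; apply/eqP/dvdn_add1_sqr => //.
  by rewrite expn_gt0 q_gt0.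
have oNK : ~~ (ordmod q l %| K)%N.
  rewrite ordmod_dvd // eqn_mod1_dvd ?expn_gt0 ?q_gt0 //; apply/negP => lqK'.
  have : (l %| 2)%N.
    move: lqK; rewrite -(prednK (_ : 0 < q ^ K)%N) ?expn_gt0 ?q_gt0 //.
    by rewrite addn1 -addn2 dvdn_addr.
  move/dvdn_leq => /(_ isT); case: l l_gt1 odd_l {l_gt0 co_ql o_gt0 o2K lqK lqK'} => // -[] // [] //.
apply/eqP; rewrite eqn_leq; apply/andP; split.
  rewrite (leq_trans (dvdn_leq_log 2 _ o2K)) ?muln_gt0 //.
  by rewrite lognM // lognE /= (lognE 2 K) dvdn2 odd_K /= andbF.
rewrite -(pfactor_dvdn 1) // expn1.
apply: contraR oNK => odd_o.
by rewrite -(Gauss_dvdr K (_ : coprime _ 2)) // coprimen2 -[odd _]negbK -dvdn2.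
Qed.

(** [K] is half the order: [l] divides (q^K - 1)(q^K + 1), and minimality of the order rules out the
    first factor. *)
Lemma ordmod_even_dvd (q l : nat) : prime l -> coprime q l ->
  logn 2 (ordmod q l) = 1%N -> exists2 K, odd K & (l %| q ^ K + 1)%N.
Proof.
move=> pr_l co_ql a1; have l_gt0 := prime_gt0 pr_l.
have q_gt0 := coprime_gt0l (prime_gt1 pr_l) co_ql.
have [o_gt0 qo1 min_o] := ordmodP l_gt0 co_ql.
have [m co_2m def_o] := pfactor_coprime (isT : prime 2) o_gt0.
rewrite a1 expn1 in def_o; rewrite coprime2n in co_2m.
exists m => //; move: qo1 => /eqP; rewrite def_o eqn_mod_dvd ?expn_gt0 ?q_gt0 //.
rewrite expnM -[X in (_ - X)%N](exp1n 2) subn_sqr Euclid_dvdM // => /orP[lm|//].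
have m_gt0 : (0 < m)%N by case: m co_2m {def_o lm}.
suff : (ordmod q l <= m)%N by rewrite def_o leqNgt ltn_Pmulr.
by apply: min_o => //; apply/eqP; rewrite eqn_mod_dvd ?expn_gt0 ?q_gt0.
Qed.

(** As [l] is odd, x^l + 1 = x^l - (-1)^l is x + 1 times a cofactor, which [l] divides because x is
    -1 modulo [l]. *)
Lemma dvdn_add1_lift (l s x : nat) : odd l -> (0 < s)%N ->
  (l ^ s %| x + 1 -> l ^ s.+1 %| x ^ l + 1)%N.
Proof.
move=> odd_l s_gt0 lsx.
have toZ y : (Posz (y + 1) = y%:Z - (-1))%R by rewrite PoszD opprK.
have lx : (l %| x%:Z - (-1))%Z.
  rewrite -toZ; apply: dvdn_trans lsx.
  by rewrite -[X in (X %| _)%N]expn1 dvdn_exp2l.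
suff : ((l ^ s.+1)%:Z %| (x ^ l + 1)%:Z)%Z by [].
have -> : (x ^ l + 1)%:Z = x%:Z ^+ l - (-1) ^+ l.
  by rewrite toZ -[in RHS]signr_odd odd_l expr1 -natz natrX natz.
rewrite subrXX expnSr PoszM dvdz_mul //.
(* Modulo [l] each summand is (-1)^(l-1) = 1, whence the total [l]. *)
have -> : \sum_(i < l) x%:Z ^+ (l.-1 - i) * (-1) ^+ i =
  \sum_(i < l) (x%:Z ^+ (l.-1 - i) - (-1) ^+ (l.-1 - i)) * (-1) ^+ i + l%:Z.
  have -> : l%:Z = \sum_(i < l) 1 by rewrite sumr_const card_ord natz.
  rewrite -big_split /=; apply: eq_bigr => i _.
  have le_i : (i <= l.-1)%N by rewrite -ltnS (ltn_predK (ltn_ord i)).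
  have even_l1 : odd l.-1 = false by case: (l) odd_l => //= n /negPf.
  by rewrite mulrBl -exprD subnK // -[(-1) ^+ l.-1]signr_odd even_l1 expr0 subrK.
rewrite rpredD ?dvdzz // rpred_sum // => i _.
by rewrite dvdz_mulr // subrXX dvdz_mulr.
Qed.

Lemma prod_prime_power_dvd_add1 (q t : nat) (l r : nat -> nat) :
  (forall i, (i < t)%N -> [/\ prime (l i), odd (l i), coprime (l i) q & (0 < r i)%N]) ->
  {in gtn t &, injective l} ->
  (forall i, (i < t)%N -> logn 2 (ordmod q (l i)) = 1%N) ->
  exists2 K, odd K & (\prod_(i < t) l i ^ r i %| q ^ K + 1)%N.
Proof.
elim: t => [|t IH] Hl inj_l a1; first by exists 1%N; rewrite ?big_ord0 ?dvd1n.
have [||i lti|K odd_K dvdK] := IH.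
- by move=> i lti; apply/Hl/ltnW.
- by move=> i j; rewrite !inE => lti ltj; apply: inj_l; rewrite inE ltnW.
- exact/a1/ltnW.
have [pr_l odd_l co_lq r_gt0] := Hl t (ltnSn t).
have [|k odd_k dvdk] := ordmod_even_dvd pr_l _ (a1 t (ltnSn t)).
  by rewrite coprime_sym.
(* Each further factor [l t] on the left costs one odd factor [l t] in the exponent. *)
have [k' odd_k' dvdk'] : exists2 k', odd k' & (l t ^ r t %| q ^ k' + 1)%N.
  elim: (r t) r_gt0 => // -[|s] IHs _; first by exists k => //; rewrite expn1.
  have [//|k' odd_k' dvdk'] := IHs; exists (k' * l t)%N; first by rewrite oddM odd_k'.
  by rewrite expnM dvdn_add1_lift.
(* Odd multiples of an exponent keep the divisibility, so the product of the two exponents serves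
   both coprime factors. *)
exists (K * k')%N; first by rewrite oddM odd_K.
rewrite big_ord_recr /= Gauss_dvd; last first.
  rewrite coprime_sym; apply: coprime_prodr => i _.
  have [pr_i _ _ _] := Hl i (ltnW (ltn_ord i)).
  rewrite coprimeXl // coprimeXr // prime_coprime // dvdn_prime2 //.
  apply/eqP => /inj_l; rewrite !inE ltnSn ltnS (ltnW (ltn_ord i)) => /(_ isT isT) ti.
  by have := ltn_ord i; rewrite -ti ltnn.
apply/andP; split; last rewrite mulnC.
  by rewrite expnM (dvdn_trans dvdK) ?dvdn_add1_exp_odd.
by rewrite expnM (dvdn_trans dvdk') ?dvdn_add1_exp_odd.
Qed.

(** * Powers of the Frobenius as ring morphisms *)

Section PowerFrobenius.
Variables (R : comNzRingType) (n : nat).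

(* The unused proof argument lets the ring morphism structure be inferred. *)
Definition frobenius_pow of [pchar R].-nat n := fun x : R => x ^+ n.

Hypothesis n_pchar : [pchar R].-nat n.

Fact frobenius_pow_zmod_morphism : zmod_morphism (frobenius_pow n_pchar).
Proof. by move=> x y; rewrite /frobenius_pow exprDn_pchar ?exprNn_pchar. Qed.

Fact frobenius_pow_monoid_morphism : monoid_morphism (frobenius_pow n_pchar).
Proof. by split=> [|x y]; rewrite /frobenius_pow ?expr1n ?exprMn. Qed.

HB.instance Definition _ :=
  GRing.isZmodMorphism.Build R R (frobenius_pow n_pchar) frobenius_pow_zmod_morphism.
HB.instance Definition _ :=
  GRing.isMonoidMorphism.Build R R (frobenius_pow n_pchar) frobenius_pow_monoid_morphism.
End PowerFrobenius.

(** * Roots in an algebraically closed extension, and their conjugates *)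

Section RootsOverClosure.
Variables (F : finFieldType) (K : closedFieldType) (phi : {rmorphism F -> K}).
Local Notation "f ^i" := (map_poly phi f) (at level 2, format "f ^i").
Local Notation Q := #|F|.

Hypothesis Q_pchar : [pchar K].-nat Q.

(** The map x -> x^Q is a ring morphism of [K] fixing the image of [F], hence the coefficients of
    [f]. *)
Lemma root_map_card_pow (f : {poly F}) (b : K) : root f^i b -> root f^i (b ^+ Q).
Proof.
have -> : b ^+ Q = frobenius_pow Q_pchar b by [].
have {2}-> : f^i = map_poly (frobenius_pow Q_pchar) f^i.
  rewrite -map_poly_comp; apply: eq_map_poly => a /=.
  by rewrite /frobenius_pow -rmorphXn expf_card.
by rewrite fmorph_root.
Qed.

Lemma root_map_card_pow_iter (f : {poly F}) (b : K) j :
  root f^i b -> root f^i (b ^+ (Q ^ j)).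
Proof.
move=> fb; elim: j => [|j IH]; first by rewrite expr1.
by rewrite expnSr exprM root_map_card_pow.
Qed.

(** X^Q - X already splits over [F] into the factors X - a, so it gains no new roots in [K]. *)
Lemma card_pow_fixed (x : K) : x ^+ Q = x -> exists a, x = phi a.
Proof.
move=> xQ; have : root (map_poly phi ('X^Q - 'X)) x.
  by rewrite rmorphB /= map_polyXn map_polyX rootE !hornerE xQ subrr.
rewrite finField_genPoly rmorph_prod /=.
under eq_bigr do rewrite rmorphB /= map_polyX map_polyC.
rewrite -(big_map phi xpredT (fun z => 'X - z%:P)) root_prod_XsubC.
by case/mapP => a _ ->; exists a.
Qed.

Lemma map_poly_descent (p : {poly K}) :
  map_poly (frobenius_pow Q_pchar) p = p -> exists h : {poly F}, p = h^i.
Proof.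
move=> /polyP p_fix.
have /fin_all_exists[a aP] : forall i : 'I_(size p), exists a, p`_i = phi a.
  by move=> i; apply: card_pow_fixed; rewrite -{2}p_fix coef_map.
exists (\poly_(i < size p) oapp a 0 (insub i)); apply/polyP => i.
rewrite coef_map coef_poly; case: ltnP => [lti|ge]; first by rewrite insubT /= -aP.
by rewrite nth_default //; symmetry; apply: rmorph0.
Qed.

(** Otherwise [f] and [g] are coprime over [F], hence also over [K], and share no root. *)
Lemma map_irreducible_dvdp (f g : {poly F}) (b : K) :
  irreducible_poly f -> root f^i b -> root g^i b -> f %| g.
Proof.
move=> irr_f fb gb; apply: contraLR gb => nfg.
by apply: coprimep_root fb; rewrite coprimep_map irreducible_poly_coprime.
Qed.

Lemma irreducible_closure_root (f : {poly F}) :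
  irreducible_poly f -> exists b, root f^i b.
Proof. by case=> sf _; apply/closed_rootP; rewrite size_map_poly gtn_eqF. Qed.

Lemma prim_root_pow_ordmod d (b : K) : coprime Q d -> d.-primitive_root b ->
  b ^+ (Q ^ ordmod Q d) = b.
Proof.
move=> co_Qd b_prim; have [_ Qo1 _] := ordmodP (prim_order_gt0 b_prim) co_Qd.
by rewrite -(prim_expr_mod b_prim) Qo1 (prim_expr_mod b_prim) expr1.
Qed.

(** For [b] of order [d] coprime to Q this is the Frobenius orbit of [b], which closes up after
    ord_d(Q) steps. *)
Definition conjugates d (b : K) := [seq b ^+ (Q ^ j) | j <- iota 0 (ordmod Q d)].

(** Equal entries make Q^i and Q^j congruent modulo [d]; cancelling Q^i contradicts the minimality
    of the order. *)
Lemma conjugates_uniq d (b : K) : coprime Q d -> d.-primitive_root b ->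
  uniq (conjugates d b).
Proof.
move=> co_Qd b_prim; have d_gt0 := prim_order_gt0 b_prim.
have [_ _ min_o] := ordmodP d_gt0 co_Qd.
have Q_gt0 k : (0 < Q ^ k)%N by rewrite expn_gt0 (cardD1 0) inE.
suff inj i j : (i <= j < ordmod Q d)%N -> b ^+ (Q ^ i) = b ^+ (Q ^ j) -> i = j.
  rewrite map_inj_in_uniq ?iota_uniq // => i j; rewrite !mem_iota !add0n /= => lti ltj bij.
  by case/orP: (leq_total i j) => ij; [|symmetry]; apply: inj; rewrite ?ij.
case/andP=> le_ij ltj /eqP; rewrite (eq_prim_root_expr b_prim) eq_sym => bij.
apply/eqP; rewrite eqn_leq le_ij /= -subn_eq0 eqn0Ngt; apply/negP => ij_gt0.
have : (ordmod Q d <= j - i)%N.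
  apply: min_o => //; apply/eqP; move: bij; rewrite eq_sym.
  rewrite -{1}(subnK le_ij) eq_sym !eqn_mod_dvd //; last by rewrite expnD leq_pmull.
  rewrite expnD -[X in (_ - X)%N]mul1n -mulnBl Gauss_dvdl //.
  by rewrite coprime_sym coprimeXl.
by rewrite leqNgt (leq_ltn_trans (leq_subr _ _) ltj).
Qed.

(** Frobenius permutes the conjugates, so their product descends to some [h] over [F]. Then [f]
    divides [h] by irreducibility, and [h] divides [f] because the conjugates are distinct roots of
    [f]. *)
Lemma conjugates_root_irreducible d (b : K) (f : {poly F}) :
  coprime Q d -> d.-primitive_root b ->
  f \is monic -> irreducible_poly f -> root f^i b ->
  f^i = \prod_(z <- conjugates d b) ('X - z%:P).
Proof.
move=> co_Qd b_prim mon_f irr_f fb.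
have [o_gt0 _ _] := ordmodP (prim_order_gt0 b_prim) co_Qd.
set p := \prod_(z <- _) _.
have [h def_h] : exists h, p = h^i.
  have := prim_root_pow_ordmod co_Qd b_prim.
  rewrite /p /conjugates; case: (ordmod Q d) o_gt0 => // m _ bQm.
  apply: map_poly_descent; rewrite !big_map rmorph_prod.
  under eq_bigr do rewrite rmorphB /= map_polyX map_polyC /= /frobenius_pow -exprM -expnSr.
  (* Frobenius shifts the orbit by one place; the last factor becomes X - b and moves to the
     front. *)
  rewrite -[m.+1 in LHS]addn1 iotaD big_cat big_seq1 /= add0n bQm mulrC.
  by rewrite big_cons expr1 (iotaDl 1 0 m) big_map.
rewrite def_h; congr map_poly; apply/eqP; rewrite -eqp_monic //; last first.
  by rewrite -(map_monic phi) -def_h monic_prod_XsubC.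
rewrite /eqp; apply/andP; split.
  apply: map_irreducible_dvdp irr_f fb _; rewrite -def_h root_prod_XsubC.
  by apply/mapP; exists 0%N; rewrite ?mem_iota ?expr1.
rewrite -(dvdp_map phi) -def_h uniq_roots_dvdp //.
  by apply/allP=> _ /mapP[j _ ->]; apply: root_map_card_pow_iter.
by rewrite uniq_rootsE conjugates_uniq.
Qed.

End RootsOverClosure.

(** * Powers of a primitive root of unity, counted by order *)

(** For z of order N, N / gcd(i, N) is the order of z^i. With N = e d, the indices counted are the j
    e with j < d coprime to d. *)
Lemma count_divn_gcdn (N d : nat) : (0 < N)%N -> (d %| N)%N ->
  (\sum_(i < N) (N %/ gcdn i N == d))%N = totient d.
Proof.
move=> N_gt0 /dvdnP[e def_N].
have [e_gt0 d_gt0] : (0 < e /\ 0 < d)%N by apply/andP; rewrite -muln_gt0 -def_N.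
have lt_je (j : 'I_d) : (j * e < N)%N by rewrite def_N mulnC ltn_pmul2l.
pose h j := Ordinal (lt_je j).
have inj_h : injective h.
  by move=> i j [] /eqP; rewrite eqn_pmul2r // => /eqP/val_inj.
rewrite totient_count_coprime big_mkord -!(big_mkcond _ (fun=> 1%N)) /=.
rewrite !sum1dep_card -(card_imset _ inj_h); apply: eq_card => i.
have divE (j : nat) : (N %/ gcdn (j * e) N == d)%N = coprime d j.
  rewrite def_N (mulnC e) -muln_gcdl divnMr // /coprime gcdnC.
  have g_gt0 : (0 < gcdn d j)%N by rewrite gcdn_gt0 d_gt0.
  rewrite -(eqn_pmul2r g_gt0) divnK ?dvdn_gcdl // -[X in X == _]muln1 eqn_pmul2l //.
rewrite inE; apply/eqP/imsetP => [Ni|[j]]; last first.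
  by rewrite inE => co_dj ->; apply/eqP; rewrite divE.
have gE : gcdn i N = e.
  apply/eqP; rewrite -(eqn_pmul2l d_gt0) -[d in X in X == _]Ni divnK ?dvdn_gcdr //.
  by rewrite def_N mulnC.
have /dvdnP[k def_i] : (e %| i)%N by rewrite -gE dvdn_gcdl.
have ltk : (k < d)%N by rewrite -(ltn_pmul2r e_gt0) -def_i (leq_trans (ltn_ord i)) // def_N mulnC.
exists (Ordinal ltk); last exact: val_inj.
by rewrite inE -divE -def_i Ni.
Qed.

Lemma sum_divn_gcdn (N : nat) (G : nat -> rat) : (0 < N)%N ->
  \sum_(i < N) G (N %/ gcdn i N)%N = \sum_(d <- divisors N) (totient d)%:R * G d.
Proof.
move=> N_gt0; transitivity
  (\sum_(i < N) \sum_(d <- divisors N) ((N %/ gcdn i N)%N == d)%:R * G d).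
  apply: eq_bigr => i _.
  rewrite (bigD1_seq (N %/ gcdn i N)%N) ?divisors_uniq //=; last first.
    by rewrite -dvdn_divisors // -[X in (_ %| X)%N](divnK (dvdn_gcdr i N)) dvdn_mulr.
  by rewrite eqxx mul1r big1 ?addr0 // => d; rewrite eq_sym => /negPf->; rewrite mul0r.
rewrite exchange_big; apply: eq_big_seq => d; rewrite -dvdn_divisors // => dN.
by rewrite -mulr_suml -(count_divn_gcdn N_gt0 dN) natr_sum.
Qed.

(** The powers of [z] run once through all N-th roots of unity, and [c] consists of such roots. *)
Lemma sum_prim_root_mem (K : fieldType) N (z : K) (c : seq K) :
  N.-primitive_root z -> uniq c -> {in c, forall x, x ^+ N = 1} ->
  (\sum_(i < N) (z ^+ i \in c))%N = size c.
Proof.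
move=> z_prim uniq_c c1.
rewrite -(big_mkcond _ (fun=> 1%N)) /= -(big_map (fun i : 'I_N => z ^+ i) [in c] (fun=> 1%N)).
rewrite sum1_count -size_filter; apply/perm_size/uniq_perm => //.
  rewrite filter_uniq // map_inj_uniq ?index_enum_uniq // => i j /eqP.
  by rewrite (eq_prim_root_expr z_prim) !modn_small // => /eqP/val_inj.
move=> x; rewrite mem_filter andb_idr // => cx.
have [i ->] := prim_rootP z_prim (c1 x cx).
by apply: map_f; rewrite mem_index_enum.
Qed.

(** X^N - 1 is separable, so it has N distinct roots, and a field with that many N-th roots of unity
    has a primitive one. *)
Lemma closed_field_prim_root (K : closedFieldType) N : N%:R != 0 :> K ->
  exists z : K, N.-primitive_root z.
Proof.
move=> nzN; have N_gt0 : (0 < N)%N by rewrite lt0n; apply: contraNneq nzN => ->.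
have [r def_r] := closed_field_poly_normal ('X^N - 1 : {poly K}).
have mon : 'X^N - 1 \is @monic K by rewrite monicXnsubC.
rewrite (monicP mon) scale1r in def_r.
have size_r : size r = N.
  by apply/succn_inj; rewrite -(size_prod_XsubC _ id) -def_r size_XnsubC.
have : has N.-primitive_root r; last by case/hasP => z _; exists z.
apply: has_prim_root => //; last by rewrite size_r.
  by apply/allP => x rx; rewrite /root_of_unity def_r root_prod_XsubC.
by rewrite -separable_prod_XsubC -def_r separable_Xn_sub_1.
Qed.

(** * SCRIM polynomials, recognised by the order of a root *)

Section Scrim.
Variables (F : finFieldType) (q : nat) (K : closedFieldType) (phi : {rmorphism F -> K}).
Local Notation "f ^i" := (map_poly phi f) (at level 2, format "f ^i").
Hypotheses (cardF : #|F| = (q ^ 2)%N) (q_pchar : [pchar F].-nat q).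

Lemma closure_pchar : [pchar K].-nat q.
Proof. by rewrite (eq_pnat _ (fmorph_pchar phi)). Qed.

Lemma closure_card_pchar : [pchar K].-nat #|F|.
Proof. by rewrite cardF pnatX closure_pchar. Qed.

Lemma coprime_card d : coprime q d -> coprime #|F| d.
Proof. by move=> co_qd; rewrite cardF coprimeXl. Qed.

Lemma dvdp_Xn_sub_1_root (f : {poly F}) (b : K) n :
  irreducible_poly f -> root f^i b -> (f %| 'X^n - 1) = (b ^+ n == 1).
Proof.
move=> irr_f fb; have rootE : root ('X^n - 1)^i b = (b ^+ n == 1).
  by rewrite rmorphB /= rmorph1 map_polyXn rootE !hornerE subr_eq0.
rewrite -rootE; apply/idP/idP => [|gb]; last exact: map_irreducible_dvdp fb gb.
by case/dvdpP => g ->; rewrite rmorphM rootM fb orbT.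
Qed.

Lemma dagger_size_monic (f : {poly F}) : f`_0 != 0 ->
  size (dagger q f) = size f /\ dagger q f \is monic.
Proof.
move=> f0; have sf_gt0 : (0 < size f)%N.
  by rewrite lt0n size_poly_eq0; apply: contraNneq f0 => ->; rewrite coef0.
have -> : dagger q f = map_poly (frobenius_pow q_pchar) (recip f) by [].
have nzE : f`_((size f).-1 - (size f).-1) != 0 by rewrite subnn.
rewrite size_map_poly monicE lead_coef_map /recip lead_coefZ.
by rewrite size_scale ?invr_eq0 // size_poly_eq // lead_coef_poly // subnn mulVf // rmorph1.
Qed.

(** [recip f] vanishes at b^-1, its value there being a multiple of b^(-deg f) f(b); raising the
    coefficients to the power q raises the root to the power q. *)
Lemma root_dagger (f : {poly F}) (b : K) : f`_0 != 0 -> b != 0 ->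
  root f^i b -> root (dagger q f)^i (b^-1 ^+ q).
Proof.
move=> f0 b0 fb.
have -> : (dagger q f)^i = map_poly (frobenius_pow closure_pchar) (recip f)^i.
  rewrite -!map_poly_comp; apply: eq_map_poly => a /=.
  by rewrite /frobenius_pow /qconj rmorphXn.
rewrite -[b^-1 ^+ q]/(frobenius_pow closure_pchar b^-1) fmorph_root.
rewrite /recip map_polyZ rootZ ?fmorph_eq0 ?invr_eq0 //.
set p := \poly_(_ < _) _.
have -> : p^i = \poly_(i < size f) phi f`_((size f).-1 - i).
  apply/polyP => i; rewrite coef_map !coef_poly.
  by case: ifP => // _; exact: rmorph0.
rewrite rootE horner_poly (reindex_inj rev_ord_inj) /=.
apply/eqP; transitivity (b ^- (size f).-1 * f^i.[b]); last by rewrite (rootP fb) mulr0.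
rewrite horner_coef size_map_poly mulr_sumr; apply: eq_bigr => i _.
have le_i : (i <= (size f).-1)%N by rewrite -ltnS (ltn_predK (ltn_ord i)).
have -> : (size f - i.+1 = (size f).-1 - i)%N by rewrite -subn1 -subnDA add1n.
rewrite subKn // coef_map exprVn -{2}(subnK le_i) exprD invfM mulrCA; congr (_ * _).
by rewrite -mulrA mulVf ?mulr1 // expf_neq0.
Qed.

Lemma coef0_irreducible_neq0 (f : {poly F}) (b : K) :
  irreducible_poly f -> root f^i b -> b != 0 -> f`_0 != 0.
Proof.
move=> irr_f fb; apply: contraNneq => f0.
have : f %| 'X.
  apply: (@map_irreducible_dvdp _ _ phi _ _ 0) irr_f _ _.
    by rewrite rootE -[0](rmorph0 phi) horner_map horner_coef0 f0 rmorph0.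
  by rewrite map_polyX rootX.
by case/dvdpP => g Xg; rewrite -rootX -(map_polyX phi) Xg rmorphM rootM fb orbT.
Qed.

Lemma prim_root_neq0 d (b : K) : d.-primitive_root b -> b != 0.
Proof.
move=> b_prim; apply/eqP => b0; have /eqP := prim_expr_order b_prim.
by rewrite b0 expr0n gtn_eqF ?(prim_order_gt0 b_prim) // eq_sym oner_eq0.
Qed.

(* The roots of [f] are the b^(q^(2j)) and those of [dagger q f] their images
   under x |-> x^(-q), so f = dagger q f iff b^(-q) = b^(q^(2j)) for some j. *)
Lemma dagger_fixed_iff d (b : K) (f : {poly F}) :
  coprime q d -> d.-primitive_root b -> f \is monic -> irreducible_poly f ->
  root f^i b ->
  f = dagger q f <-> exists2 k, odd k & (d %| q ^ k + 1)%N.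
Proof.
move=> co_qd b_prim mon_f irr_f fb.
have b0 := prim_root_neq0 b_prim.
have f0 := coef0_irreducible_neq0 irr_f fb b0.
split=> [f_dag | [k odd_k dvdk]].
  have := root_dagger f0 b0 fb; rewrite -f_dag.
  rewrite (conjugates_root_irreducible closure_card_pchar (coprime_card co_qd)
    b_prim mon_f irr_f fb).
  rewrite root_prod_XsubC => /mapP[j _ bj].
  have dvdj : (d %| q ^ (2 * j) + q)%N.
    by rewrite (prim_order_dvd b_prim) exprD expnM -cardF -bj exprVn mulVf ?expf_neq0.
  (* For j = 0 this says that d divides q + 1; otherwise a factor q, coprime to d, splits off and
     leaves q^(2j-1) + 1. *)
  case: j {bj} dvdj => [|j] dvdj; first by exists 1%N; rewrite // addnC.
  exists (2 * j).+1; first by rewrite /= mul2n odd_double.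
  move: dvdj; rewrite mulnS add2n expnS -[X in (_ + X)%N]muln1 -mulnDr Gauss_dvdr //.
  by rewrite coprime_sym.
have [sz_dag mon_dag] := dagger_size_monic f0.
apply/eqP; rewrite -eqp_monic // -dvdp_size_eqp ?sz_dag //.
apply: (map_irreducible_dvdp irr_f fb).
(* With k = 2m + 1, the conjugate b^(Q^m) yields the root b^(-q^k) of [dagger q f], which is [b]
   since d divides q^k + 1. *)
have kE : (#|F| ^ k./2 * q = q ^ k)%N.
  by rewrite cardF -expnM -expnSr mul2n -[in RHS](odd_double_half k) odd_k.
have := root_map_card_pow_iter closure_card_pchar k./2 fb.
move/(root_dagger f0); rewrite expf_neq0 // => /(_ isT).
rewrite exprVn -exprM kE; congr (root _ _).
move: dvdk; rewrite (prim_order_dvd b_prim) addn1 exprS => /eqP bk.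
by rewrite -[LHS]mul1r -bk mulfK // expf_neq0.
Qed.

Lemma scrimP (f : {poly F}) (b : K) d :
  coprime q d -> d.-primitive_root b -> root f^i b ->
  scrim q f <-> [/\ f \is monic, irreducible_poly f &
                    exists2 k, odd k & (d %| q ^ k + 1)%N].
Proof.
move=> co_qd b_prim fb; rewrite /scrim; split.
  case/and4P => mon_f /irreducibleP irr_f f0 /eqP f_dag; split=> //.
  exact/(dagger_fixed_iff co_qd b_prim mon_f irr_f fb).
case=> mon_f irr_f /(dagger_fixed_iff co_qd b_prim mon_f irr_f fb) f_dag.
rewrite mon_f -f_dag eqxx (introT (irreducibleP _) irr_f) andbT.
exact: coef0_irreducible_neq0 irr_f fb (prim_root_neq0 b_prim).
Qed.

(** Lists the divisors as plain polynomials, so that the sets for different [n], living in different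
    bounded-degree types, can be compared. *)
Lemma Omega_card_enum n : (0 < n)%N ->
  exists s : seq {poly F}, [/\ size s = Omega_card F q n, uniq s &
    forall f, (f \in s) = scrim q f && (f %| 'X^n - 1)].
Proof.
move=> n_gt0; set A := [set f : {poly_(n.+1) F} | scrim q f && (polyn f %| 'X^n - 1)].
exists [seq polyn f | f <- enum A]; split; first by rewrite size_map -cardE.
  by rewrite map_inj_uniq ?enum_uniq //; exact: val_inj.
move=> f; apply/mapP/idP => [[g] | /[dup] Pf /andP[_ f_dvd]].
  by rewrite mem_enum inE => + ->.
have sf : (size f <= n.+1)%N.
  by rewrite -(size_XnsubC (1 : F) n_gt0) dvdp_leq // -size_poly_eq0 size_XnsubC.
by exists (NPoly sf) => //; rewrite mem_enum inE.
Qed.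

(** [d] is the order of a root of [f] in [K]. *)
Lemma scrim_dvdp_Xn_sub_1 (f : {poly F}) n :
  coprime q n -> (0 < n)%N -> scrim q f -> f %| 'X^n - 1 ->
  exists d k, [/\ (d %| n)%N, odd k, (d %| q ^ k + 1)%N &
    forall m, (f %| 'X^m - 1) = (d %| m)%N].
Proof.
move=> co_qn n_gt0 scr_f f_dvd.
have irr_f : irreducible_poly f by case/and4P: scr_f => _ /irreducibleP.
have [b fb] := irreducible_closure_root phi irr_f.
move: f_dvd; rewrite (dvdp_Xn_sub_1_root _ irr_f fb) => /eqP bn.
have [d b_prim dn] := prim_order_exists n_gt0 bn.
have co_qd : coprime q d by rewrite (coprime_dvdr dn).
have [_ _ [k odd_k dvdk]] := (scrimP co_qd b_prim fb).1 scr_f.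
exists d, k; split=> // m.
by rewrite (dvdp_Xn_sub_1_root _ irr_f fb) (prim_order_dvd b_prim).
Qed.

Lemma Omega_card_eq n n' : coprime q n -> (0 < n)%N -> (n' %| n)%N ->
  (forall d k, odd k -> d %| n -> d %| q ^ k + 1 -> d %| n')%N ->
  Omega_card F q n = Omega_card F q n'.
Proof.
move=> co_qn n_gt0 dvd_n' good.
have n'_gt0 := dvdn_gt0 n_gt0 dvd_n'.
have [s [<- uniq_s mem_s]] := Omega_card_enum n_gt0.
have [s' [<- uniq_s' mem_s']] := Omega_card_enum n'_gt0.
apply/perm_size/uniq_perm => // f; rewrite mem_s mem_s'.
have [scr_f /= | //] := boolP (scrim q f); apply/idP/idP => f_dvd.
  have [d [k [dn odd_k dk ->]]] := scrim_dvdp_Xn_sub_1 co_qn n_gt0 scr_f f_dvd.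
  exact: good odd_k dn dk.
have co_qn' := coprime_dvdr dvd_n' co_qn.
have [d [k [dn' _ _ ->]]] := scrim_dvdp_Xn_sub_1 co_qn' n'_gt0 scr_f f_dvd.
exact: dvdn_trans dn' dvd_n'.
Qed.

Hypothesis phi_integral : integralRange phi.

Lemma minimal_poly_exists (b : K) :
  exists f : {poly F}, [/\ f \is monic, irreducible_poly f & root f^i b].
Proof.
(* [F] is finite, so membership in the image of [phi] is decided by search. *)
have dec_phi : decidable_embedding phi.
  move=> y; apply: (@decP _ [exists x, y == phi x]).
  by apply: (iffP existsP) => -[x yx]; exists x; [exact/eqP | rewrite yx].
have [f [mon_f fb irr_f]] := minPoly_decidable_closure dec_phi (phi_integral b).
by exists f.
Qed.

(* Double counting of the pairs (z^i, f) with z^i a root of f, each pair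
   weighted by 1 / deg f. *)
Lemma Omega_card_sum n k : coprime q n -> (0 < n)%N -> odd k -> (n %| q ^ k + 1)%N ->
  (Omega_card F q n)%:R =
    \sum_(d <- divisors n) ((totient d)%:R / (ordmod (q ^ 2) d)%:R : rat).
Proof.
move=> co_qn n_gt0 odd_k dvdk.
have [s [<- uniq_s mem_s]] := Omega_card_enum n_gt0.
(* The characteristic of [K] is a prime factor of q, and n is coprime to q. *)
have nzn : n%:R != 0 :> K.
  have q_gt1 : (1 < q)%N.
    by rewrite -(ltn_exp2r _ _ (isT : 0 < 2)%N) exp1n -cardF finRing_gt1.
  have pK : pdiv q \in [pchar K].
    by rewrite (pnatPpi closure_pchar) // pi_pdiv.
  rewrite -(dvdn_pcharf pK) -prime_coprime ?pdiv_prime //.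
  exact: coprime_dvdl (pdiv_dvd q) co_qn.
have [z z_prim] := closed_field_prim_root nzn.
have z_ord i := exp_prim_root z_prim i.
have ord_dvd i : (n %/ gcdn i n %| n)%N.
  by rewrite -[X in (_ %| X)%N](divnK (dvdn_gcdr i n)) dvdn_mulr.
have co_ord i := coprime_dvdr (ord_dvd i) co_qn.
have rootsE f i : f \is monic -> irreducible_poly f -> root f^i (z ^+ i) ->
    f^i = \prod_(x <- conjugates F (n %/ gcdn i n) (z ^+ i)) ('X - x%:P).
  by apply: conjugates_root_irreducible; rewrite ?closure_card_pchar ?coprime_card.
have size_root f i : f \is monic -> irreducible_poly f -> root f^i (z ^+ i) ->
    (size f).-1 = ordmod #|F| (n %/ gcdn i n).
  move=> mon_f irr_f fz; rewrite -(size_map_poly phi) (rootsE _ i) //.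
  by rewrite size_prod_XsubC size_map size_iota.
rewrite -cardF -(sum_divn_gcdn (fun d => (ordmod #|F| d)%:R^-1) n_gt0).
(* Each [f] in [s] has exactly deg f roots among the z^i, so its inner sum is 1. *)
transitivity (\sum_(f <- s) \sum_(i < n) (root f^i (z ^+ i))%:R / (size f).-1%:R : rat).
  rewrite -sum1_size natr_sum; apply: eq_big_seq => f.
  rewrite mem_s => /andP[/and4P[mon_f /irreducibleP irr_f _ _] f_dvd].
  rewrite -mulr_suml -natr_sum.
  have [b fb] := irreducible_closure_root phi irr_f.
  move: f_dvd; rewrite (dvdp_Xn_sub_1_root _ irr_f fb) => /eqP bn.
  have [i def_b] := prim_rootP z_prim bn; rewrite {b}def_b in fb bn.
  have [f_gt1 _] := irr_f.
  rewrite (rootsE _ _ mon_f irr_f fb).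
  under eq_bigr do rewrite root_prod_XsubC.
  rewrite (sum_prim_root_mem z_prim).
  - rewrite size_map size_iota (size_root _ _ mon_f irr_f fb) divff // pnatr_eq0.
    by rewrite -(size_root _ _ mon_f irr_f fb) -lt0n -ltnS prednK // ltnW.
  - by apply: conjugates_uniq; rewrite ?coprime_card.
  - by move=> _ /mapP[j _ ->]; rewrite (exprAC _ _ n) bn expr1n.
(* Conversely, z^i is a root of exactly one [f] in [s], its minimal polynomial, which is SCRIM
   because the order of z^i divides n and so q^k + 1. *)
rewrite exchange_big; apply: eq_bigr => i _.
have [f [mon_f irr_f fz]] := minimal_poly_exists (z ^+ i).
have sf : f \in s.
  rewrite mem_s (dvdp_Xn_sub_1_root _ irr_f fz) exprAC (prim_expr_order z_prim).
  rewrite expr1n eqxx andbT; apply/(scrimP (co_ord i) (z_ord i) fz).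
  by split=> //; exists k => //; apply: dvdn_trans (ord_dvd i) dvdk.
rewrite (bigD1_seq f) //= fz (size_root _ _ mon_f irr_f fz) mul1r big_seq_cond.
(* Another [g] in [s] with root z^i would be the product over the same conjugates, hence equal to
   [f]. *)
rewrite big1 ?addr0 // => g; rewrite mem_s.
case/andP=> /andP[/and4P[mon_g /irreducibleP irr_g _ _] _] neq_gf.
case: (boolP (root _ _)) => [gz | _]; last by rewrite mul0r.
case/eqP: neq_gf; apply: (map_poly_inj phi).
by rewrite (rootsE _ _ mon_g irr_g gz) (rootsE _ _ mon_f irr_f fz).
Qed.

End Scrim.

(** * Assembly of the three cases *)

Lemma ordmod1r (a : nat) : ordmod a 1 = 1%N.
Proof. by rewrite /ordmod /= !modn1. Qed.

(** If [l] divided [d], it would divide q^k + 1 with k odd, and the order of q modulo [l] would be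
    twice an odd number. *)
Lemma coprime_prime_pow_dvdn_add1 (q l r d k : nat) :
  prime l -> odd l -> coprime l q -> logn 2 (ordmod q l) != 1%N ->
  odd k -> (d %| q ^ k + 1)%N -> coprime d (l ^ r).
Proof.
move=> pr_l odd_l co_lq a1 odd_k dk; rewrite coprimeXr // coprime_sym prime_coprime //.
apply: contra a1 => ld; apply/eqP.
apply: (logn2_ordmod odd_l (prime_gt1 pr_l) _ odd_k (dvdn_trans ld dk)).
by rewrite coprime_sym.
Qed.

(** Since d_i is odd, a_i is the 2-adic valuation of the order, hence [logn 2]. *)
Theorem theorem2p14 (q : nat) (F : finFieldType) (t : nat) (l r : nat -> nat) :
  prime_power q -> #|F| = (q ^ 2)%N ->
  (forall i, (i < t)%N -> [/\ prime (l i), odd (l i), coprime (l i) q & (0 < r i)%N]) ->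
  {in gtn t &, injective l} ->
  let a := fun i => logn 2 (ordmod q (l i)) in
  let N := (\prod_(i < t) l i ^ r i)%N in
  [/\ (forall j, (j < t)%N -> (a j == 0%N) || (2 <= a j)%N ->
         Omega_card F q N = Omega_card F q (\prod_(i < t | i != j :> nat) l i ^ r i)%N),
      ((forall i, (i < t)%N -> a i = 1%N) ->
         (Omega_card F q N)%:R =
           \sum_(d <- divisors N) ((totient d)%:R / (ordmod (q ^ 2) d)%:R : rat))
    & ((forall i, (i < t)%N -> a i != 1%N) -> Omega_card F q N = 1%N)].
Proof.
move=> [p [e [pr_p _ def_q]]] cardF Hl inj_l a N.
have [K [phi phi_int]] := countable_algebraic_closure F.
have q_pchar : [pchar F].-nat q.
  rewrite def_q pnatX pnatE // (card_finPcharP (n := e * 2)) //.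
  by rewrite cardF def_q expnM.
have co_qN : coprime q N.
  apply: coprime_prodr => i _; have [_ _ co_lq _] := Hl i (ltn_ord i).
  by rewrite coprimeXr // coprime_sym.
have N_gt0 : (0 < N)%N.
  apply: prodn_cond_gt0 => i _; have [pr_l _ _ _] := Hl i (ltn_ord i).
  by rewrite expn_gt0 prime_gt0.
split=> [j ltj aj | a1 | a1].
- have def_N : N = (l j ^ r j * \prod_(i < t | i != j :> nat) l i ^ r i)%N.
    by rewrite /N (bigD1 (Ordinal ltj)).
  apply: (Omega_card_eq phi cardF q_pchar co_qN N_gt0); first by rewrite def_N dvdn_mull.
  move=> d k odd_k dN dk; have [pr_l odd_l co_lq _] := Hl j ltj.
  (* [d] divides N and is coprime to l_j^r_j, so it divides the remaining product. *)
  rewrite def_N Gauss_dvdr // in dN.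
  apply: coprime_prime_pow_dvdn_add1 odd_k dk => //.
  by rewrite -/(a j); case: (a j) aj => [|[]].
- have [k odd_k dvdk] := prod_prime_power_dvd_add1 Hl inj_l a1.
  exact: (Omega_card_sum cardF q_pchar phi_int co_qN N_gt0 odd_k dvdk).
have -> : Omega_card F q N = Omega_card F q 1.
  apply: (Omega_card_eq phi cardF q_pchar co_qN N_gt0); first exact: dvd1n.
  (* [d] divides N but is coprime to every factor of N, so it divides 1. *)
  move=> d k odd_k dN dk; rewrite -(@Gauss_dvdr d N) ?muln1 //.
  apply: coprime_prodr => i _; have [pr_l odd_l co_lq _] := Hl i (ltn_ord i).
  exact: coprime_prime_pow_dvdn_add1 (a1 i (ltn_ord i)) odd_k dk.
(* For n = 1 the counting formula, with k = 1, has a single term, equal to 1. *)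
apply/eqP; rewrite -(eqr_nat rat).
rewrite (Omega_card_sum (k := 1) cardF q_pchar phi_int) ?coprimen1 ?dvd1n //.
by rewrite big_seq1 ordmod1r divr1 eqr_nat.
Qed.
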